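(* Let $X$ be an absolutely continuous nonnegative random variable with density function $f(x)$ and distribution function $F(x)$, let $(t_1,t_2)\in D$, and let $\beta\ge 1$, $\beta-1<\alpha<\beta$. Then $$H_{\alpha,\beta}^{w}(X;t_1,t_2)\ \ge\ \frac{\alpha+\beta-1}{\beta-\alpha}\int_{t_1}^{t_2}\frac{f(x)}{F(t_2)-F(t_1)}\log x\,dx+\left(\frac{2-\alpha-\beta}{\beta-\alpha}\right)H(X;t_1,t_2),$$ where $$H(X;t_1,t_2)=-\int_{t_1}^{t_2}\frac{f(x)}{F(t_2)-F(t_1)}\log\frac{f(x)}{F(t_2)-F(t_1)}\,dx$$ is the interval Shannon entropy.
   Context: Let $X$ be a nonnegative absolutely continuous random variable with density $f$ and distribution function $F$, and let $D=\{(u,v)\in\mathbb{R}_+^2: F(u)<F(v)\}$. For $(t_1,t_2)\in D$, $\beta\ge 1$ and $\beta-1<\alpha<\beta$, the weighted generalized interval entropy (WGIE) of order $(\alpha,\beta)$ of $X$ is $$H_{\alpha,\beta}^{w}(X;t_1,t_2)=\frac{1}{\beta-\alpha}\log\int_{t_1}^{t_2}\left(\frac{x f(x)}{F(t_2)-F(t_1)}\right)^{\alpha+\beta-1}dx .$$ The integrals involved are assumed to be well defined and finite. *)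

(* Defs.v *)
From HB Require Import structures.
From mathcomp Require Import all_boot all_order all_algebra.
From mathcomp Require Import all_classical all_reals all_analysis.

Set Implicit Arguments.
Unset Strict Implicit.
Unset Printing Implicit Defensive.

Import Order.TTheory GRing.Theory Num.Theory.

Local Open Scope classical_set_scope.
Local Open Scope ring_scope.

(* [cdf] takes values in the extended reals; it is always finite. *)
Definition distr_fun d (T : measurableType d) (R : realType)
    (P : probability T R) (X : {RV P >-> R}) (t : R) : R :=
  fine (cdf X t).

(* Having a density in this sense is absolute continuity with respect to the
   Lebesgue measure. *)
Definition is_density d (T : measurableType d) (R : realType)
    (P : probability T R) (X : {RV P >-> R}) (f : R -> R) : Prop :=
  [/\ measurable_fun [set: R] f,
      forall x, 0 <= f x &
      forall A : set R, measurable A ->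
        distribution P X A = (\int[lebesgue_measure]_(x in A) (f x)%:E)%E].

Definition interval_domain d (T : measurableType d) (R : realType)
    (P : probability T R) (X : {RV P >-> R}) : set (R * R) :=
  [set uv | [/\ 0 <= uv.1, 0 <= uv.2 &
                distr_fun X uv.1 < distr_fun X uv.2]].

(* The density of X conditioned on t1 <= X <= t2, for f a density of X. *)
Definition interval_density d (T : measurableType d) (R : realType)
    (P : probability T R) (X : {RV P >-> R}) (f : R -> R) (t1 t2 x : R) : R :=
  f x / (distr_fun X t2 - distr_fun X t1).

(* Integrands below use [0 `^ p = 0] for [p != 0] and [ln 0 = 0], so that
   [0 * ln 0 = 0]. *)
Definition wgie_integrand d (T : measurableType d) (R : realType)
    (P : probability T R) (X : {RV P >-> R}) (f : R -> R)
    (alpha beta t1 t2 x : R) : R :=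
  ((x * f x) / (distr_fun X t2 - distr_fun X t1)) `^ (alpha + beta - 1).

Definition wgie d (T : measurableType d) (R : realType)
    (P : probability T R) (X : {RV P >-> R}) (f : R -> R)
    (alpha beta t1 t2 : R) : R :=
  1 / (beta - alpha) *
  ln (\int[lebesgue_measure]_(x in `[t1, t2])
        wgie_integrand X f alpha beta t1 t2 x).

Definition shannon_integrand d (T : measurableType d) (R : realType)
    (P : probability T R) (X : {RV P >-> R}) (f : R -> R) (t1 t2 x : R) : R :=
  interval_density X f t1 t2 x * ln (interval_density X f t1 t2 x).

Definition interval_shannon_entropy d (T : measurableType d) (R : realType)
    (P : probability T R) (X : {RV P >-> R}) (f : R -> R) (t1 t2 : R) : R :=
  - \int[lebesgue_measure]_(x in `[t1, t2]) shannon_integrand X f t1 t2 x.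

(* Main.v *)
Require Import Defs.
From HB Require Import structures.
From mathcomp Require Import all_boot all_order all_algebra.
From mathcomp Require Import all_classical all_reals all_analysis.
From mathcomp Require Import measurable_realfun ring.

(** Write [w] for the density of [X] conditioned on [t1 < X <= t2] and
    [p = alpha + beta - 1], which is positive.  For [x > 0] the quotient of the
    integrand [(x w)^p] of the weighted entropy by [w] satisfies
    [w ln ((x w)^p / w) = p (w ln x) + (p - 1) (w ln w)], whose integral is
    [beta - alpha] times the right-hand side of the theorem.  As [w] is a
    probability density and [ln] is concave, Jensen's inequality bounds the
    integral of the left-hand side by [ln (\int (x w)^p)], which is
    [beta - alpha] times the weighted entropy ([gibbs_inequality] and
    [mul_ln_powR_div]).

    Two degenerate cases need care.  The conventions [ln 0 = 0] and
    [0 `^ p = 0] break the pointwise identity at [x = 0], so all integrals are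
    taken over [`]t1, t2]], which changes nothing for the Lebesgue measure; the
    mass of [w] on that interval is 1 by [Rintegral_interval_density].  Also,
    [ln] of a vanishing integral would be [0] instead of [-oo];
    [gibbs_inequality] rules this case out from the integrability of its
    left-hand side. *)

Set Implicit Arguments.
Unset Strict Implicit.
Unset Printing Implicit Defensive.

Import Order.TTheory GRing.Theory Num.Theory.

Local Open Scope classical_set_scope.
Local Open Scope ring_scope.

(** The tangent line of [ln] at [c], evaluated at [u / w] and multiplied by
    [w].  The implication between [u = 0] and [w = 0] is absolute continuity:
    with [ln 0 = 0] the left-hand side would vanish where its true value is
    [-oo]. *)
Lemma mul_ln_div_le (R : realType) (u w c : R) :
  0 <= u -> 0 <= w -> (u = 0 -> w = 0) -> 0 < c ->
  w * ln (u / w) <= c^-1 * u + (ln c - 1) * w.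
Proof.
move=> u0; rewrite le_eqVlt => /predU1P[<- _|w0 uw] c0.
  by rewrite mul0r mulr0 addr0 => *; rewrite mulr_ge0// invr_ge0 ltW.
have {}u0 : 0 < u.
  by rewrite lt_def u0 andbT; apply: contraTneq w0 => /uw ->; rewrite ltxx.
have y0 : 0 < u / w / c by rewrite !divr_gt0.
have lny : ln (u / w / c) <= u / w / c - 1.
  by rewrite -{1}(subrKC 1 (u / w / c)) le_ln1Dx// ltrBrDl subrr.
have -> : ln (u / w) = ln (u / w / c) + ln c.
  by rewrite -lnM ?posrE// divfK// gt_eqF.
have -> : c^-1 * u + (ln c - 1) * w = w * (u / w / c - 1 + ln c).
  by field; rewrite !gt_eqF.
by rewrite ler_pM2l// lerD2r.
Qed.

(** Gibbs' inequality, equivalently Jensen's inequality for [ln] under the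
    probability density [w].  Integrating the tangent-line bound gives
    [\int w ln (u / w) <= c^-1 \int u + ln c - 1] for every [c > 0], and the
    best choice of [c] is [\int u]. *)
Lemma gibbs_inequality d (T : measurableType d) (R : realType)
    (mu : {measure set T -> \bar R}) (D : set T) (u w : T -> R) :
  measurable D ->
  (forall x, D x -> 0 <= u x) -> (forall x, D x -> 0 <= w x) ->
  (forall x, D x -> u x = 0 -> w x = 0) ->
  mu.-integrable D (EFin \o u) -> mu.-integrable D (EFin \o w) ->
  mu.-integrable D (fun x => (w x * ln (u x / w x))%:E) ->
  \int[mu]_(x in D) w x = 1 ->
  \int[mu]_(x in D) (w x * ln (u x / w x)) <= ln (\int[mu]_(x in D) u x).
Proof.
move=> mD u0 w0 uw iu iw il w1.
have tangent (c : R) : 0 < c ->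
    \int[mu]_(x in D) (w x * ln (u x / w x)) <=
    c^-1 * \int[mu]_(x in D) u x + (ln c - 1).
  move=> c0.
  have icu : mu.-integrable D (EFin \o (fun x => c^-1 * u x)).
    exact: (integrableZl mD _ iu).
  have icw : mu.-integrable D (EFin \o (fun x => (ln c - 1) * w x)).
    exact: (integrableZl mD _ iw).
  rewrite -[X in _ + X]mulr1 -{2}w1 -!RintegralZl// -RintegralD//.
  apply: le_Rintegral => // [|x Dx]; first exact: (integrableD mD icu icw).
  by apply: mul_ln_div_le => //; [exact: u0|exact: w0|exact: uw].
have : 0 <= \int[mu]_(x in D) u x by exact: Rintegral_ge0.
rewrite le_eqVlt => /predU1P[U0|U0]; last first.
  by have := tangent _ U0; rewrite mulVf ?gt_eqF// subrKC.
(* If [\int u = 0], the bounds for all [c] have no finite lower bound, so the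
   left-hand integral could not be a real number; one value of [c] shows it. *)
exfalso.
set I := \int[mu]_(x in D) _ in tangent.
have := tangent (expR I) (expR_gt0 _).
by rewrite -U0 mulr0 add0r expRK lerBrDr gerDl ler10.
Qed.

Section interval_density.
Context d (T : measurableType d) (R : realType) (P : probability T R)
  (X : {RV P >-> R}) (f : R -> R) (t1 t2 : R).
Hypotheses (f_density : is_density X f)
  (t12 : distr_fun X t1 < distr_fun X t2).

Let mu := @lebesgue_measure R.

Lemma distr_fun_lt : t1 < t2.
Proof.
rewrite ltNge; apply: contraTN t12 => t21; rewrite -leNgt /distr_fun.
by apply: fine_le; rewrite ?fin_num_measure//; exact: cdf_nondecreasing.
Qed.

Lemma integral_density_itv :
  (\int[mu]_(x in `]t1, t2]) (f x)%:E =
   (distr_fun X t2 - distr_fun X t1)%:E)%E.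
Proof.
have [_ _ <-//] := f_density.
have fc t : (distr_fun X t)%:E = distribution P X `]-oo, t].
  by rewrite fineK// fin_num_measure.
rewrite EFinB !fc.
rewrite (@itv_bndbnd_setU _ _ -oo%O (BRight t1) (BRight t2))//; last first.
  by rewrite bnd_simp ltW// distr_fun_lt.
rewrite measureU//; last first.
  rewrite -subset0 => x [] /=; rewrite !in_itv/= => xt1 /andP[+ _].
  by rewrite ltNge xt1.
by rewrite addeAC subee ?add0e// fin_num_measure.
Qed.

Let D_gt0 : 0 < distr_fun X t2 - distr_fun X t1.
Proof. by rewrite subr_gt0. Qed.

Lemma interval_density_ge0 x : 0 <= interval_density X f t1 t2 x.
Proof. by have [_ f0 _] := f_density; rewrite divr_ge0// ltW. Qed.

Lemma integrable_interval_density :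
  mu.-integrable `]t1, t2] (EFin \o interval_density X f t1 t2).
Proof.
have [mf f0 _] := f_density.
have -> : EFin \o interval_density X f t1 t2 =
    (fun x => (distr_fun X t2 - distr_fun X t1)^-1%:E * (f x)%:E)%E.
  by apply/funext => x; rewrite /= /interval_density mulrC EFinM.
apply: integrableZl => //; apply/integrableP; split.
  by apply/measurable_EFinP; exact: measurable_funTS.
under eq_integral do rewrite gee0_abs ?lee_fin//.
by rewrite integral_density_itv ltry.
Qed.

Lemma Rintegral_interval_density :
  \int[mu]_(x in `]t1, t2]) interval_density X f t1 t2 x = 1.
Proof.
have [mf f0 _] := f_density; rewrite /Rintegral.
under eq_integral do rewrite /interval_density EFinM.
rewrite ge0_integralZr//; last 3 first.
- by apply/measurable_EFinP; exact: measurable_funTS.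
- by move=> x _; rewrite lee_fin.
- by rewrite lee_fin invr_ge0 ltW.
by rewrite integral_density_itv -EFinM divff// gt_eqF.
Qed.

End interval_density.

Lemma integrable_itv_obnd (R : realType) (a b : R) (h : R -> R) :
  (@lebesgue_measure R).-integrable `[a, b] (EFin \o h) ->
  (@lebesgue_measure R).-integrable `]a, b] (EFin \o h).
Proof. by apply: integrableS => //; exact: subset_itv_oc_cc. Qed.

(** This splits the integrand of [gibbs_inequality] into those of the
    logarithmic moment and of the Shannon entropy.  At [x = 0] it can
    fail: for [p != 0] the left-hand side is [0] there because [ln 0 = 0],
    while [(p - 1) * (w * ln w)] need not vanish. *)
Lemma mul_ln_powR_div (R : realType) (p x w : R) : 0 < x -> 0 <= w ->
  w * ln ((x * w) `^ p / w) = p * (w * ln x) + (p - 1) * (w * ln w).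
Proof.
move=> x0; rewrite le_eqVlt => /predU1P[<-|w0].
  by rewrite !(mul0r, mulr0) addr0.
rewrite ln_div ?posrE ?powR_gt0 ?mulr_gt0// ln_powR lnM ?posrE//.
by ring.
Qed.

Theorem theorem2p6 (R : realType) (d : measure_display) (T : measurableType d)
    (P : probability T R) (X : {RV P >-> R}) (f : R -> R)
    (X_ge0 : {ae P, forall w, 0 <= X w})
    (f_density : is_density X f)
    (t1 t2 alpha beta : R)
    (t12D : interval_domain X (t1, t2))
    (beta_ge1 : 1 <= beta)
    (alpha_gt : beta - 1 < alpha)
    (alpha_lt : alpha < beta)
    (wgie_int : (@lebesgue_measure R).-integrable `[t1, t2]
       (fun x => (wgie_integrand X f alpha beta t1 t2 x)%:E))
    (log_int : (@lebesgue_measure R).-integrable `[t1, t2]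
       (fun x => (interval_density X f t1 t2 x * ln x)%:E))
    (shannon_int : (@lebesgue_measure R).-integrable `[t1, t2]
       (fun x => (shannon_integrand X f t1 t2 x)%:E)) :
  wgie X f alpha beta t1 t2 >=
    (alpha + beta - 1) / (beta - alpha) *
      (\int[lebesgue_measure]_(x in `[t1, t2])
         (interval_density X f t1 t2 x * ln x)) +
    ((2 - alpha - beta) / (beta - alpha)) *
      interval_shannon_entropy X f t1 t2.
Proof.
have [/= t1_ge0 _ t12] := t12D.
set p := alpha + beta - 1.
have p0 : 0 < p.
  by rewrite /p -addrA ltr_wpDr ?subr_ge0// (le_lt_trans _ alpha_gt)// subr_ge0.
set w := interval_density X f t1 t2.
have w0 x : 0 <= w x by exact: interval_density_ge0.
have uE x : wgie_integrand X f alpha beta t1 t2 x = (x * w x) `^ p.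
  by rewrite /wgie_integrand mulrA.
have x0 (x : R) : [set` `]t1, t2]] x -> 0 < x.
  by rewrite /= in_itv/= => /andP[+ _]; exact: le_lt_trans.
have {wgie_int}iu := integrable_itv_obnd wgie_int.
have {log_int}il := integrable_itv_obnd log_int.
have {shannon_int}ish := integrable_itv_obnd shannon_int.
(* Dropping the left endpoint makes [x] positive even when [t1 = 0]. *)
rewrite /wgie /interval_shannon_entropy -!Rintegral_itv_obnd_cbnd//.
have ipl : lebesgue_measure.-integrable `]t1, t2]
    (EFin \o (fun x => p * (w x * ln x))) by exact: (integrableZl _ _ il).
have ips : lebesgue_measure.-integrable `]t1, t2]
    (EFin \o (fun x => (p - 1) * shannon_integrand X f t1 t2 x)).
  exact: (integrableZl _ _ ish).
have splitE : {in [set` `]t1, t2]],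
    (fun x => w x * ln (wgie_integrand X f alpha beta t1 t2 x / w x)) =1
    (fun x => p * (w x * ln x) + (p - 1) * shannon_integrand X f t1 t2 x)}.
  by move=> x /set_mem/x0 x_gt0; rewrite uE mul_ln_powR_div.
have gibbs : \int[lebesgue_measure]_(x in `]t1, t2])
      (w x * ln (wgie_integrand X f alpha beta t1 t2 x / w x)) <=
    ln (\int[lebesgue_measure]_(x in `]t1, t2])
      wgie_integrand X f alpha beta t1 t2 x).
  apply: gibbs_inequality => //.
  - by move=> x _; exact: powR_ge0.
  - move=> x /x0 x_gt0; rewrite uE => /powR_eq0_eq0/eqP.
    by rewrite mulf_eq0 gt_eqF//= => /eqP.
  - exact: integrable_interval_density.
  - apply: eq_integrable (integrableD _ ipl ips) => // x xD.
    by rewrite /= splitE.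
  - exact: Rintegral_interval_density.
move: gibbs; under eq_Rintegral => x xD do rewrite (splitE _ xD).
rewrite RintegralD// !RintegralZl//.
set L := \int[lebesgue_measure]_(x in `]t1, t2]) (w x * ln x).
set S := \int[lebesgue_measure]_(x in `]t1, t2])
  shannon_integrand X f t1 t2 x.
move=> gibbs.
have -> : p / (beta - alpha) * L + (2 - alpha - beta) / (beta - alpha) * - S =
    1 / (beta - alpha) * (p * L + (p - 1) * S).
  by rewrite /p; ring.
by rewrite ler_wpM2l// divr_ge0// subr_ge0 ltW.
Qed.
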